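(* Let $n,m>0$ be real constants with $n\neq m$, let $S$ and $P$ be constants, and let $f(y),k(y)$ be smooth nonvanishing real functions on a real interval. Consider the extended Liénard equation for $y=y(x)$, $$y''+f(y)(y')^n+k(y)(y')^m=0.$$ If the coefficients satisfy the condition $$\frac{d}{dy}\left[\left(\frac{f(y)}{k(y)}\right)^{\frac{1}{n-m}}\right]=SP^{2-m}f(y)\left[\frac{f(y)}{k(y)}\right]^{\frac{3-n}{n-m}},$$ or $$\frac{d}{dy}\left[\left(\frac{f(y)}{k(y)}\right)^{\frac{1}{n-m}}\right]=SP^{2-m}k(y)\left[\frac{f(y)}{k(y)}\right]^{\frac{3-m}{n-m}},$$ then the general solution of the extended Liénard equation can be obtained as $$x-x_0=P\int\left[\frac{f(y)}{k(y)}\right]^{\frac{1}{n-m}}\theta(y)\,dy,$$ where $x_0$ is an arbitrary integration constant and $$\theta(y)=H^{-1}\left\{P^{2-m}\int k(y)\left[\frac{f(y)}{k(y)}\right]^{\frac{2-m}{n-m}}dy\right\},$$ with $$H(\theta)=\int\frac{d\theta}{P^{m-n}\theta^{3-n}+\theta^{3-m}-S\theta},$$ i.e. $\theta(y)$ is determined by $H(\theta)=P^{2-m}\int k(y)\left[\frac{f(y)}{k(y)}\right]^{\frac{2-m}{n-m}}dy$.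
   Context: Primes denote derivatives with respect to $x$. $H$ is an antiderivative and $H^{-1}$ its (local) inverse function; the antiderivative in the argument of $H^{-1}$ contains an arbitrary additive constant of integration. ''General solution'' is meant in the classical sense: a family of solutions depending on as many arbitrary constants as the order of the equation, on domains where all expressions are defined. It is understood that the real powers appearing are defined, e.g. $P>0$, $f/k>0$, $\theta>0$ and $y'>0$ when the exponents are not integers. *)

(* Defs.v *)
From Stdlib Require Import Reals.
From Coquelicot Require Import Coquelicot.
Open Scope R_scope.

Definition is_int (a : R) : Prop := exists z : Z, a = IZR z.

(* Real power x^a, meaningful for x > 0 and any a, and for x < 0 when a is an
   integer, in which case [Int_part (IZR z) = z]. Stdlib's [Rpower] alone has
   no meaningful values at x < 0. *)
Definition rpow (x a : R) : R :=
  if Rlt_dec 0 x then Rpower x a else powerRZ x (Int_part a).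

(* Admissible bases for P, theta and y': their exponents m, n, 2-m, m-n, 3-n,
   3-m are all integers iff m and n are; otherwise the base must be positive. *)
Definition pow_ok (n m x : R) : Prop :=
  0 < x \/ (x <> 0 /\ is_int n /\ is_int m).

Definition is_open_interval (I : R -> Prop) : Prop :=
  open I /\ (exists x, I x) /\
  (forall a b x, I a -> I b -> a <= x <= b -> I x).

Definition smooth_on (I : R -> Prop) (f : R -> R) : Prop :=
  forall (j : nat) (y : R), I y -> ex_derive_n f j y.

Definition antiderivative_on (A : R -> Prop) (u U : R -> R) : Prop :=
  forall y, A y -> is_derive U y (u y).

Definition quot_pow (f k : R -> R) (e y : R) : R := rpow (f y / k y) e.

(* Solutions with nowhere vanishing derivative (dx/dy occurs in the formula). *)
Definition lienard_solution (n m : R) (f k : R -> R) (I J : R -> Prop)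
    (y : R -> R) : Prop :=
  forall x, J x ->
    I (y x) /\ ex_derive y x /\ ex_derive (Derive y) x /\
    pow_ok n m (Derive y x) /\
    Derive (Derive y) x + f (y x) * rpow (Derive y x) n
      + k (y x) * rpow (Derive y x) m = 0.

Definition H_denominator (n m S P t : R) : R :=
  rpow P (m - n) * rpow t (3 - n) + rpow t (3 - m) - S * t.

(* H and its local inverse are considered on such intervals T of values of
   theta. *)
Definition theta_interval (n m S P : R) (T : R -> Prop) : Prop :=
  is_open_interval T /\
  forall t, T t -> pow_ok n m t /\ H_denominator n m S P t <> 0.

(* [K] is one fixed antiderivative; [c] is the arbitrary additive constant in
   the argument of H^{-1}. *)
Definition theta (m P : R) (Hinv K : R -> R) (c y : R) : R :=
  Hinv (rpow P (2 - m) * (K y + c)).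

Definition theta_domain (m P : R) (I T : R -> Prop) (H K : R -> R)
    (c y : R) : Prop :=
  I y /\ exists t, T t /\ H t = rpow P (2 - m) * (K y + c).

(* [X c] is one fixed antiderivative for each [c]: its additive constant is
   absorbed by x0. *)
Definition quadratures (n m S P : R) (f k : R -> R) (I T : R -> Prop)
    (H Hinv K : R -> R) (X : R -> R -> R) : Prop :=
  antiderivative_on T (fun t => 1 / H_denominator n m S P t) H /\
  (forall t, T t -> Hinv (H t) = t) /\
  antiderivative_on I
    (fun y => k y * quot_pow f k ((2 - m) / (n - m)) y) K /\
  (forall c, antiderivative_on (theta_domain m P I T H K c)
    (fun y => quot_pow f k (1 / (n - m)) y * theta m P Hinv K c y) (X c)).

Definition family_member (m P : R) (I T : R -> Prop) (H K : R -> R)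
    (X : R -> R -> R) (c x0 : R) (J : R -> Prop) (y : R -> R) : Prop :=
  forall x, J x ->
    theta_domain m P I T H K c (y x) /\ x - x0 = P * X c (y x).

(* The value of theta along a solution, from dx/dy = P (f/k)^(1/(n-m)) theta. *)
Definition theta_along (n m P : R) (f k y : R -> R) (x : R) : R :=
  1 / (P * quot_pow f k (1 / (n - m)) (y x) * Derive y x).

(* Main.v *)
(** With g = (f/k)^(1/(n-m)), both forms of the condition say
    g' = S P^(2-m) k g^(3-m). Define theta along a curve by
    dx/dy = P g(y) theta. The Lienard equation is then equivalent to the separable
    equation dtheta/dy = P^(2-m) k g^(2-m) D(theta), where D is the denominator
    in H, i.e. to H(theta) = P^(2-m) (K(y) + c); one more quadrature gives x.
    All the derivatives involved are continuous and nowhere zero, so H, the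
    argument of H^(-1) and x as a function of y are strictly monotone with open
    images and differentiable inverses. *)

Require Import Defs.
From Stdlib Require Import Reals Lra ZArith ClassicalEpsilon.
From Coquelicot Require Import Coquelicot.
Open Scope R_scope.

(** * Real powers with positive base or integer exponent *)

(** Two obstacles shape the proof. For a negative base the laws of exponents need integer exponents,
    so [(f/k)^(a/(n-m))] cannot be split freely. [quot_pow_base] settles this once; the analysis
    then treats [g] abstractly, through [f = k g^(n-m)], its admissibility as a base and its
    derivative. The objects of the formula also come without regularity: [Hinv] is only a left
    inverse of [H] on [T], and a family member [y] only satisfies a pointwise relation. Their
    continuity and differentiability are derived from the strict monotonicity of the functions they
    invert. Conversely, a given solution has two first integrals, [H(theta) - P^(2-m) K(y)] and
    [x - P X c (y)]. Their constant values determine [c] and [x0], which gives both completeness of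
    the family and uniqueness of the constants. *)

Lemma is_int_plus (a b : R) : is_int a -> is_int b -> is_int (a + b).
Proof. intros [p ->] [q ->]. exists (p + q)%Z. now rewrite plus_IZR. Qed.

Lemma is_int_minus (a b : R) : is_int a -> is_int b -> is_int (a - b).
Proof. intros [p ->] [q ->]. exists (p - q)%Z. now rewrite minus_IZR. Qed.

Lemma is_int_opp (a : R) : is_int a -> is_int (- a).
Proof. intros [p ->]. exists (- p)%Z. now rewrite opp_IZR. Qed.

Lemma is_int_IZR (z : Z) : is_int (IZR z).
Proof. now exists z. Qed.

(** The single-exponent form of [pow_ok], under which the laws of exponents hold. *)
Definition powerable (a x : R) : Prop := 0 < x \/ (x <> 0 /\ is_int a).

Lemma rpow_pos_base (x a : R) : 0 < x -> rpow x a = Rpower x a.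
Proof. intros hx. unfold rpow. destruct (Rlt_dec 0 x); [easy | contradiction]. Qed.

(** Both branches of [rpow] agree at integer exponents, so no case distinction on the sign of the
    base is needed there. *)
Lemma rpow_IZR (x : R) (z : Z) : rpow x (IZR z) = powerRZ x z.
Proof.
  unfold rpow. destruct (Rlt_dec 0 x) as [hx | _].
  - now rewrite powerRZ_Rpower.
  - now rewrite <- (Int_part_spec (IZR z) z) by lra.
Qed.

Lemma rpow_neq_0 (x a : R) : x <> 0 -> rpow x a <> 0.
Proof.
  intros hx. unfold rpow. destruct (Rlt_dec 0 x).
  - apply Rgt_not_eq, exp_pos.
  - now apply powerRZ_NOR.
Qed.

Lemma rpow_pos (x a : R) : 0 < x -> 0 < rpow x a.
Proof. intros hx. rewrite rpow_pos_base by easy. apply exp_pos. Qed.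

Lemma rpow_plus (x a b : R) :
  powerable a x -> powerable b x -> rpow x (a + b) = rpow x a * rpow x b.
Proof.
  intros [hx | [hx [p ->]]].
  - intros _. rewrite !rpow_pos_base by easy. apply Rpower_plus.
  - intros [hx' | [_ [q ->]]].
    + rewrite !rpow_pos_base by easy. apply Rpower_plus.
    + rewrite <- plus_IZR, !rpow_IZR. now apply powerRZ_add.
Qed.

Lemma rpow_mult_distr (x y a : R) :
  powerable a x -> powerable a y -> rpow (x * y) a = rpow x a * rpow y a.
Proof.
  intros [hx | [_ [p ->]]].
  - intros [hy | [_ [p ->]]].
    + rewrite !rpow_pos_base by (try easy; now apply Rmult_lt_0_compat).
      now rewrite Rpower_mult_distr.
    + rewrite !rpow_IZR. apply powerRZ_mult.
  - intros _. rewrite !rpow_IZR. apply powerRZ_mult.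
Qed.

Lemma powerRZ_powerRZ (x : R) (p q : Z) :
  x <> 0 -> powerRZ (powerRZ x p) q = powerRZ x (p * q).
Proof.
  intros hx. pose proof (powerRZ_NOR x p hx) as hp.
  induction q as [|q IH|q IH] using Z.peano_ind.
  - now rewrite Z.mul_0_r.
  - rewrite Z.mul_succ_r, <- Z.add_1_r, !powerRZ_add, IH by easy.
    now rewrite powerRZ_1.
  - rewrite Z.mul_pred_r, <- Z.sub_1_r. unfold Z.sub.
    rewrite !powerRZ_add, IH, !powerRZ_neg' by easy. now rewrite powerRZ_1.
Qed.

(** Both exponents must be integers when [x < 0]: otherwise (x^2)^(1/2) = |x| would be a
    counterexample. *)
Lemma rpow_rpow (x a b : R) :
  powerable a x -> powerable b x -> rpow (rpow x a) b = rpow x (a * b).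
Proof.
  assert (pos : 0 < x -> rpow (rpow x a) b = rpow x (a * b)).
  { intros hx. rewrite (rpow_pos_base (rpow x a)) by now apply rpow_pos.
    rewrite !rpow_pos_base by easy. apply Rpower_mult. }
  intros [hx | [hx [p ->]]] [hx' | [_ [q ->]]]; auto.
  rewrite <- mult_IZR, !rpow_IZR. now apply powerRZ_powerRZ.
Qed.

Lemma rpow_1 (x : R) : rpow x 1 = x.
Proof. rewrite rpow_IZR. apply powerRZ_1. Qed.

Lemma rpow_nat (x : R) (j : nat) : rpow x (INR j) = x ^ j.
Proof. now rewrite INR_IZR_INZ, rpow_IZR, <- pow_powerRZ. Qed.

Lemma rpow_opp (x a : R) : powerable a x -> rpow x (- a) = / rpow x a.
Proof.
  intros [hx | [hx [p ->]]].
  - rewrite !rpow_pos_base by easy. apply Rpower_Ropp.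
  - rewrite <- opp_IZR, !rpow_IZR. apply powerRZ_neg'.
Qed.

Lemma rpow_inv (x a : R) : powerable a x -> rpow (/ x) a = / rpow x a.
Proof.
  intros [hx | [hx [p ->]]].
  - rewrite !rpow_pos_base by (try easy; now apply Rinv_0_lt_compat).
    unfold Rpower. now rewrite ln_Rinv, <- exp_Ropp, Ropp_mult_distr_r by easy.
  - rewrite !rpow_IZR. apply powerRZ_inv'.
Qed.

Lemma continuous_powerRZ (z : Z) (x : R) :
  x <> 0 -> continuous (fun t => powerRZ t z) x.
Proof.
  intros hx.
  assert (hpow : forall j, continuous (fun t => t ^ j) x).
  { intros j. apply (ex_derive_continuous (fun t => t ^ j)). auto_derive; auto. }
  destruct z as [|p|p]; simpl.
  - apply continuous_const.
  - apply hpow.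
  - apply (continuous_comp (fun t => t ^ Pos.to_nat p) Rinv); [apply hpow|].
    apply continuous_Rinv. now apply pow_nonzero.
Qed.

Lemma continuous_rpow (a x : R) : powerable a x -> continuous (fun t => rpow t a) x.
Proof.
  intros hx. destruct (Rlt_dec 0 x) as [pos | npos].
  - apply (continuous_ext_loc _ (fun t => Rpower t a)).
    (* The ball of radius [x] around [x] contains only positive numbers, so [rpow] stays in one
       branch. *)
    + exists (mkposreal x pos). intros t ht.
      change (Rabs (t - x) < x) in ht. apply Rabs_def2 in ht.
      symmetry. apply rpow_pos_base. lra.
    + apply (ex_derive_continuous (fun t => Rpower t a)).
      unfold Rpower. auto_derive; auto.
  - destruct hx as [hx | [hx [z ->]]]; [contradiction|].
    apply (continuous_ext (fun t => powerRZ t z)).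
    + intros t. symmetry. apply rpow_IZR.
    + now apply continuous_powerRZ.
Qed.

Lemma pow_ok_neq_0 (n m x : R) : pow_ok n m x -> x <> 0.
Proof. intros [hx | [hx _]]; lra. Qed.

Lemma pow_ok_powerable (n m x a : R) :
  pow_ok n m x -> (is_int n -> is_int m -> is_int a) -> powerable a x.
Proof. intros [hx | [hx [hn hm]]] h; [now left | right; auto]. Qed.

Lemma pow_ok_mult (n m x y : R) :
  pow_ok n m x -> pow_ok n m y -> pow_ok n m (x * y).
Proof.
  intros hx hy.
  assert (x * y <> 0) by
    (apply Rmult_integral_contrapositive; split; eapply pow_ok_neq_0; eassumption).
  destruct hx as [hx | [hx hi]]; [|now right].
  destruct hy as [hy | [hy hi]]; [|now right].
  left. now apply Rmult_lt_0_compat.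
Qed.

Lemma pow_ok_inv (n m x : R) : pow_ok n m x -> pow_ok n m (/ x).
Proof.
  intros [hx | [hx hi]].
  - left. now apply Rinv_0_lt_compat.
  - right. split; [now apply Rinv_neq_0_compat | easy].
Qed.

Ltac int_exponent :=
  intros; repeat first [assumption | apply is_int_IZR | apply is_int_plus
    | apply is_int_minus | apply is_int_opp].
Ltac powerable := eapply pow_ok_powerable; [eassumption | int_exponent].

(** Normalizes exponents such as [3 - n], so that only powers with exponents [n] and [m] remain as
    atoms for [field]. *)
Lemma rpow_nat_minus (n m x a : R) (j : nat) :
  pow_ok n m x -> (is_int n -> is_int m -> is_int a) ->
  rpow x (INR j - a) = x ^ j / rpow x a.
Proof.
  intros hx ha. unfold Rminus.
  assert (hopp : is_int n -> is_int m -> is_int (- a)) by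
    (intros; apply is_int_opp; auto).
  rewrite rpow_plus, rpow_nat, rpow_opp.
  - reflexivity.
  - now apply pow_ok_powerable with n m.
  - apply pow_ok_powerable with n m; [easy|]. intros _ _.
    rewrite INR_IZR_INZ. apply is_int_IZR.
  - now apply pow_ok_powerable with n m.
Qed.

Lemma rpow_2_minus (n m x a : R) :
  pow_ok n m x -> (is_int n -> is_int m -> is_int a) ->
  rpow x (2 - a) = x ^ 2 / rpow x a.
Proof.
  intros hx ha. rewrite <- (rpow_nat_minus n m x a 2 hx ha).
  f_equal.
Qed.

Lemma rpow_3_minus (n m x a : R) :
  pow_ok n m x -> (is_int n -> is_int m -> is_int a) ->
  rpow x (3 - a) = x ^ 3 / rpow x a.
Proof.
  intros hx ha. rewrite <- (rpow_nat_minus n m x a 3 hx ha).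
  f_equal. simpl. lra.
Qed.

Lemma rpow_minus (n m x a b : R) :
  pow_ok n m x -> (is_int n -> is_int m -> is_int a /\ is_int b) ->
  rpow x (a - b) = rpow x a / rpow x b.
Proof.
  intros hx hi. unfold Rminus.
  assert (powerable b x) by (apply pow_ok_powerable with n m; [easy | apply hi]).
  rewrite rpow_plus, rpow_opp; try easy.
  - apply pow_ok_powerable with n m; [easy | apply hi].
  - apply pow_ok_powerable with n m; [easy|].
    intros; apply is_int_opp; now apply hi.
Qed.

(* With [w = P g t = dx/dy], the equation y'' + f y'^n + k y'^m = 0 reads
   dw/dy = (f w^(-n) + k w^(-m)) w^3. *)
Lemma slope_identity (n m S P f k g t : R) :
  pow_ok n m P -> pow_ok n m g -> pow_ok n m t -> f = k * rpow g (n - m) ->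
  f * rpow (/ (P * g * t)) n + k * rpow (/ (P * g * t)) m =
  (P * (S * rpow P (2 - m) * k * rpow g (3 - m)) * t +
   P * g * (rpow P (2 - m) * (k * rpow g (2 - m)) * H_denominator n m S P t)) /
  (P * g * t) ^ 3.
Proof.
  intros hP hg ht ->.
  pose proof (pow_ok_mult _ _ _ _ hP hg) as hPg.
  pose proof (pow_ok_mult _ _ _ _ hPg ht) as hw.
  rewrite !rpow_inv by powerable.
  rewrite !(rpow_mult_distr (P * g) t) by powerable.
  rewrite !(rpow_mult_distr P g) by powerable.
  unfold H_denominator.
  (* Afterwards both sides are rational expressions in [P], [g], [t] and their powers with exponents
     [n] and [m]. *)
  rewrite !(rpow_2_minus n m), !(rpow_3_minus n m), !(rpow_minus n m) by
    (try easy; int_exponent).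
  assert (hne : forall x a, pow_ok n m x -> rpow x a <> 0) by
    (intros; apply rpow_neq_0; eapply pow_ok_neq_0; eassumption).
  pose proof (pow_ok_neq_0 _ _ _ hP). pose proof (pow_ok_neq_0 _ _ _ hg).
  pose proof (pow_ok_neq_0 _ _ _ ht).
  field. repeat split; auto.
Qed.

(** * Antiderivatives of nonvanishing functions *)

(* Unlike [is_open_interval] this allows the empty set: [theta_domain] is empty for
   some constants c. *)
Definition open_convex (A : R -> Prop) : Prop :=
  open A /\ forall a b x, A a -> A b -> a <= x <= b -> A x.

Lemma open_interval_open_convex (A : R -> Prop) : is_open_interval A -> open_convex A.
Proof. intros [ho [_ hc]]. now split. Qed.

Lemma convex_minmax (A : R -> Prop) (a b x : R) :
  open_convex A -> A a -> A b -> Rmin a b <= x <= Rmax a b -> A x.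
Proof.
  intros [_ hc] ha hb hx. unfold Rmin, Rmax in hx. destruct (Rle_dec a b).
  - now apply (hc a b).
  - now apply (hc b a).
Qed.

Lemma antiderivative_continuous (A : R -> Prop) (u U : R -> R) (x : R) :
  antiderivative_on A u U -> A x -> continuous U x.
Proof. intros hU hx. apply (ex_derive_continuous U). exists (u x). now apply hU. Qed.

Lemma open_convex_antiderivative (A : R -> Prop) (u : R -> R) :
  open_convex A -> (forall x, A x -> continuous u x) ->
  exists U, antiderivative_on A u U.
Proof.
  intros hA hu. destruct (classic (exists a, A a)) as [[a ha] | none].
  - exists (RInt u a). intros x hx. apply is_derive_RInt with a; [|now apply hu].
    destruct (proj1 hA x hx) as [eps heps]. exists eps. intros b hb.
    apply (RInt_correct u), (ex_RInt_continuous u). intros z hz. apply hu.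
    apply (convex_minmax A a b); auto.
  - exists u. intros x hx. exfalso. eauto.
Qed.

Lemma open_convex_mvt (A : R -> Prop) (W w : R -> R) (a b : R) :
  open_convex A -> antiderivative_on A w W -> A a -> A b ->
  exists c, A c /\ Rmin a b <= c <= Rmax a b /\ W b - W a = w c * (b - a).
Proof.
  intros hA hW ha hb.
  destruct (MVT_gen W a b w) as [c [hc e]].
  - intros x hx. apply hW, (convex_minmax A a b); auto; lra.
  - intros x hx. apply continuity_pt_filterlim.
    apply (antiderivative_continuous A w); auto. now apply (convex_minmax A a b).
  - exists c. split; [now apply (convex_minmax A a b) | easy].
Qed.

Lemma open_convex_constant (A : R -> Prop) (W : R -> R) (a b : R) :
  open_convex A -> antiderivative_on A (fun _ => 0) W -> A a -> A b -> W a = W b.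
Proof.
  intros hA hW ha hb.
  destruct (open_convex_mvt A W _ a b hA hW ha hb) as [c [_ [_ e]]]. lra.
Qed.

Lemma open_convex_ivt (A : R -> Prop) (W : R -> R) (a b u : R) :
  open_convex A -> (forall x, A x -> continuous W x) -> A a -> A b ->
  Rmin (W a) (W b) <= u <= Rmax (W a) (W b) -> exists c, A c /\ W c = u.
Proof.
  intros hA hW ha hb hu.
  pose proof (Rmin_l a b). pose proof (Rmin_r a b).
  pose proof (Rmax_l a b). pose proof (Rmax_r a b).
  (* The intermediate value theorem is applied to a globally continuous extension [V], equal to [W]
     between [a] and [b]. *)
  destruct (C0_extension_le W (Rmin a b) (Rmax a b)) as [V [hV e]].
  { intros x hx. now apply hW, (convex_minmax A a b). }
  destruct (IVT_gen_consistent V a b u hV) as [c [hc <-]].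
  - now rewrite !e by lra.
  - exists c. split; [now apply (convex_minmax A a b) | now rewrite e].
Qed.

(** The setting of the one-dimensional inverse function theorem. It is used for [H], for the
    argument of [Hinv], for x as a function of y, and for theta along a solution. *)
Definition regular (A : R -> Prop) (w W : R -> R) : Prop :=
  open_convex A /\ antiderivative_on A w W /\
  forall x, A x -> continuous w x /\ w x <> 0.

(** A change of sign would force a zero of the continuous [w]. The factor [s] lets the increasing
    and decreasing cases be treated together. *)
Lemma regular_sign (A : R -> Prop) (w W : R -> R) :
  regular A w W ->
  exists s, (s = 1 \/ s = -1) /\ forall x, A x -> 0 < s * w x.
Proof.
  intros [hA [_ hw]]. destruct (classic (exists a, A a)) as [[a ha] | none].
  2: { exists 1. split; [now left|]. intros x hx. exfalso. eauto. }
  assert (same : forall x, A x -> 0 < w a * w x).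
  { intros x hx. destruct (Rlt_le_dec 0 (w a * w x)) as [|h]; [easy|exfalso].
    destruct (open_convex_ivt A w a x 0 hA) as [c [hc e]]; auto.
    - intros z hz. now apply hw.
    - unfold Rmin, Rmax. destruct (Rle_dec (w a) (w x)); nra.
    - now apply (proj2 (hw c hc)). }
  pose proof (same a ha).
  destruct (Rlt_le_dec 0 (w a)); [exists 1 | exists (-1)]; split; auto;
    intros x hx; specialize (same x hx); nra.
Qed.

Lemma regular_monotone (A : R -> Prop) (w W : R -> R) :
  regular A w W ->
  exists s, (s = 1 \/ s = -1) /\
    forall a b, A a -> A b -> a < b -> s * W a < s * W b.
Proof.
  intros hr. destruct (regular_sign A w W hr) as [s [hs pos]].
  exists s. split; [easy|]. intros a b ha hb hab.
  destruct hr as [hA [hW _]].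
  destruct (open_convex_mvt A W w a b hA hW ha hb) as [c [hc [_ e]]].
  specialize (pos c hc).
  assert (0 < (s * w c) * (b - a)) by (apply Rmult_lt_0_compat; lra).
  assert (s * (W b - W a) = (s * w c) * (b - a)) by (rewrite e; ring). lra.
Qed.

Lemma regular_injective (A : R -> Prop) (w W : R -> R) (a b : R) :
  regular A w W -> A a -> A b -> W a = W b -> a = b.
Proof.
  intros hr ha hb e. destruct (regular_monotone A w W hr) as [s [_ mono]].
  destruct (Rtotal_order a b) as [h | [h | h]]; [|easy|].
  - specialize (mono a b ha hb h). rewrite e in mono. lra.
  - specialize (mono b a hb ha h). rewrite e in mono. lra.
Qed.

Lemma open_around (A : R -> Prop) (a eps : R) :
  open A -> A a -> 0 < eps -> exists r, 0 < r < eps /\ A (a - r) /\ A (a + r).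
Proof.
  intros hA ha heps. destruct (hA a ha) as [d hd]. pose proof (cond_pos d).
  set (r := Rmin eps d / 2).
  assert (0 < Rmin eps d) by (apply Rmin_pos; lra).
  pose proof (Rmin_l eps d). pose proof (Rmin_r eps d).
  assert (0 < r < eps /\ r < d) by (unfold r; lra).
  exists r. split; [lra|].
  split; apply hd;
    [change (Rabs (a - r - a) < d) | change (Rabs (a + r - a) < d)];
    apply Rabs_def1; lra.
Qed.

Lemma locally_Rabs (A : R -> Prop) (a : R) :
  locally a A <-> exists d, 0 < d /\ forall x, Rabs (x - a) < d -> A x.
Proof.
  split.
  - intros [d hd]. exists d. split; [apply cond_pos | exact hd].
  - intros [d [hd h]]. exists (mkposreal d hd). exact h.
Qed.

Lemma regular_image (A : R -> Prop) (w W : R -> R) :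
  regular A w W -> (exists a, A a) ->
  is_open_interval (fun u => exists a, A a /\ W a = u).
Proof.
  intros hr [a0 ha0]. pose proof hr as [hA [hW _]].
  assert (hcont : forall x, A x -> continuous W x) by
    (intros; now apply (antiderivative_continuous A w)).
  split; [|split].
  - intros u [a [ha <-]].
    destruct (regular_monotone A w W hr) as [s [hs mono]].
    destruct (open_around A a 1 (proj1 hA) ha) as [r [hr' [h1 h2]]]; [lra|].
    pose proof (mono _ _ h1 ha ltac:(lra)) as m1.
    pose proof (mono _ _ ha h2 ltac:(lra)) as m2.
    apply locally_Rabs.
    (* By monotonicity [W (a - r)] and [W (a + r)] lie on opposite sides of [W a]; the smaller gap
       is a radius within which every value is attained. *)
    exists (Rmin (s * W a - s * W (a - r)) (s * W (a + r) - s * W a)).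
    split; [apply Rmin_pos; lra|]. intros u hu.
    pose proof (Rmin_l (s * W a - s * W (a - r)) (s * W (a + r) - s * W a)).
    pose proof (Rmin_r (s * W a - s * W (a - r)) (s * W (a + r) - s * W a)).
    apply Rabs_def2 in hu.
    apply (open_convex_ivt A W (a - r) (a + r)); auto.
    unfold Rmin, Rmax. destruct (Rle_dec (W (a - r)) (W (a + r))), hs; subst s; lra.
  - exists (W a0), a0. auto.
  - intros u v x [a [ha <-]] [b [hb <-]] hx.
    apply (open_convex_ivt A W a b); auto.
    now rewrite Rmin_left, Rmax_right by lra.
Qed.

Lemma regular_preimage (A B : R -> Prop) (w W : R -> R) :
  regular A w W -> open_convex B -> open_convex (fun x => A x /\ B (W x)).
Proof.
  intros hr [hB hBc]. pose proof hr as [[hA hAc] [hW _]]. split.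
  - intros x [hx hWx]. apply filter_and; [now apply hA|].
    apply (antiderivative_continuous A w W x hW hx). now apply hB.
  - intros a b x [ha hWa] [hb hWb] hx.
    assert (hx' : A x) by now apply (hAc a b).
    split; [easy|].
    destruct (regular_monotone A w W hr) as [s [hs mono]].
    assert (le : forall p q, A p -> A q -> p <= q -> s * W p <= s * W q).
    { intros p q hp hq [h | ->]; [left; now apply mono | lra]. }
    pose proof (le a x ha hx' ltac:(lra)). pose proof (le x b hx' hb ltac:(lra)).
    destruct hs; subst s.
    + apply (hBc (W a) (W b)); auto; lra.
    + apply (hBc (W b) (W a)); auto; lra.
Qed.

(** [V] is merely a right inverse. If [v] is closer to [u = W (V u)] than both [W (V u - r)] and
    [W (V u + r)], monotonicity of [W] keeps [V v] between [V u - r] and [V u + r]. *)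
Lemma regular_inverse_continuous (A B : R -> Prop) (w W V : R -> R) (u : R) :
  regular A w W -> open B -> (forall v, B v -> A (V v) /\ W (V v) = v) -> B u ->
  continuous V u.
Proof.
  intros hr hB hV hu. destruct (hV u hu) as [hVu e].
  destruct (regular_monotone A w W hr) as [s [hs mono]].
  intros Q hQ. apply locally_Rabs in hQ. destruct hQ as [eps [heps hQ]].
  destruct (open_around A (V u) eps) as [r [hr' [h1 h2]]]; auto; [apply hr|].
  pose proof (mono _ _ h1 hVu ltac:(lra)) as m1.
  pose proof (mono _ _ hVu h2 ltac:(lra)) as m2.
  assert (near : locally u (fun v => Rabs (v - u) <
    Rmin (s * W (V u) - s * W (V u - r)) (s * W (V u + r) - s * W (V u)))).
  { apply locally_Rabs. eexists. split; [|intros v hv; exact hv].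
    apply Rmin_pos; lra. }
  pose proof (Rmin_l (s * W (V u) - s * W (V u - r)) (s * W (V u + r) - s * W (V u))).
  pose proof (Rmin_r (s * W (V u) - s * W (V u - r)) (s * W (V u + r) - s * W (V u))).
  unfold filtermap.
  apply filter_imp with (2 := filter_and _ _ (hB u hu) near).
  intros v [hv hd]. destruct (hV v hv) as [hVv e']. apply hQ.
  apply Rabs_def2 in hd. rewrite e in *.
  apply Rabs_def1.
  - destruct (Rlt_le_dec (V v) (V u + r)) as [|[h | h]]; [lra| |].
    + specialize (mono _ _ h2 hVv h). rewrite e' in mono.
      destruct hs; subst s; lra.
    + rewrite h, e' in *. destruct hs; subst s; lra.
  - destruct (Rlt_le_dec (V u - r) (V v)) as [|[h | h]]; [lra| |].
    + specialize (mono _ _ hVv h1 h). rewrite e' in mono.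
      destruct hs; subst s; lra.
    + rewrite <- h, e' in *. destruct hs; subst s; lra.
Qed.

(** By the mean value theorem the difference quotient of [V] equals [/ w c] with [c] between [V u]
    and [V (u + x)]; continuity of [V] sends [c] to [V u]. *)
Lemma regular_inverse_derive (A B : R -> Prop) (w W V : R -> R) (u : R) :
  regular A w W -> open B -> (forall v, B v -> A (V v) /\ W (V v) = v) -> B u ->
  is_derive V u (/ w (V u)).
Proof.
  intros hr hB hV hu. destruct (hV u hu) as [hVu e].
  pose proof hr as [hA [hW hw]].
  apply is_derive_Reals. intros eps heps.
  destruct (hw _ hVu) as [cw nz].
  assert (cinv : continuous (fun v => / w v) (V u)).
  { apply (continuous_comp w Rinv); [easy|]. now apply continuous_Rinv. }
  assert (near : locally (/ w (V u)) (fun z => Rabs (z - / w (V u)) < eps)).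
  { apply locally_Rabs. exists eps. auto. }
  (* The neighbourhood is pulled back through [1 / w] to radius [r] about [V u], then through [V] to
     radius [d] about [u]. *)
  apply cinv in near. apply locally_Rabs in near.
  destruct near as [r [hr' near]].
  assert (near' : locally (V u) (fun z => Rabs (z - V u) < r)).
  { apply locally_Rabs. exists r. auto. }
  apply (regular_inverse_continuous A B w W V u hr hB hV hu) in near'.
  pose proof (filter_and _ _ (hB u hu) near') as near''.
  apply locally_Rabs in near''. destruct near'' as [d [hd h]].
  exists (mkposreal d hd). intros x hx hxd. simpl in hxd.
  destruct (h (u + x)) as [hBx hVx].
  { now replace (u + x - u) with x by ring. }
  destruct (hV _ hBx) as [hAx ex].
  destruct (open_convex_mvt A W w _ _ hA hW hVu hAx) as [c [hc [bc ec]]].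
  rewrite e, ex in ec. replace (u + x - u) with x in ec by ring.
  destruct (hw c hc) as [_ nzc].
  replace ((V (u + x) - V u) / x) with (/ w c).
  2: { apply (Rmult_eq_reg_r x); [|easy]. rewrite ec at 1. field. now split. }
  apply near. apply Rabs_def2 in hVx.
  unfold Rmin, Rmax in bc. apply Rabs_def1; destruct (Rle_dec (V u) (V (u + x))); lra.
Qed.

(** * The separable equation for theta *)

(** Turns every fractional power of [f / k] into a power of the base g with exponent free of [n - m]
    in the denominator. For negative [f / k] this needs [1 / (n - m)] to be an integer, as in
    [rpow_rpow]. *)
Lemma quot_pow_base (n m : R) (f k : R -> R) (y : R) :
  n <> m -> f y <> 0 -> k y <> 0 ->
  0 < f y / k y \/ (is_int n /\ is_int m /\ is_int (1 / (n - m))) ->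
  pow_ok n m (quot_pow f k (1 / (n - m)) y) /\
  f y = k y * rpow (quot_pow f k (1 / (n - m)) y) (n - m) /\
  forall a, (is_int n -> is_int m -> is_int a) ->
    quot_pow f k (a / (n - m)) y = rpow (quot_pow f k (1 / (n - m)) y) a.
Proof.
  intros hnm hf hk hfk. unfold quot_pow. set (r := f y / k y) in *.
  assert (hr : r <> 0).
  { apply Rmult_integral_contrapositive. split; [|apply Rinv_neq_0_compat]; easy. }
  assert (hpow : forall a, (is_int n -> is_int m -> is_int a) ->
    rpow r (a / (n - m)) = rpow (rpow r (1 / (n - m))) a).
  { intros a ha. rewrite rpow_rpow.
    - f_equal. field. lra.
    - destruct hfk as [h | [_ [_ h]]]; [now left | now right].
    - destruct hfk as [h | [h [h' _]]]; [now left | right; auto]. }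
  split; [|split; [|exact hpow]].
  - destruct hfk as [h | [h [h' _]]]; [left; now apply rpow_pos | right].
    split; [now apply rpow_neq_0 | easy].
  - rewrite <- hpow by int_exponent.
    replace ((n - m) / (n - m)) with 1 by (field; lra).
    rewrite rpow_1. unfold r. field. easy.
Qed.

Section Quadrature.

(* [g] stands for (f/k)^(1/(n-m)). *)
Variables (n m S P : R) (f k g : R -> R) (I : R -> Prop).

(** The factor of the separable equation that depends on y alone; it is also the derivative of the
    argument of [Hinv]. *)
Definition theta_rate (y : R) : R := rpow P (2 - m) * (k y * rpow (g y) (2 - m)).

Hypotheses (hP : pow_ok n m P) (hI : is_open_interval I)
  (hk : forall y, I y -> continuous k y) (hk0 : forall y, I y -> k y <> 0)
  (hg : forall y, I y -> pow_ok n m (g y))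
  (hfg : forall y, I y -> f y = k y * rpow (g y) (n - m))
  (hdg : forall y, I y ->
     is_derive g y (S * rpow P (2 - m) * k y * rpow (g y) (3 - m))).

Lemma K_integrand_continuous (y : R) :
  I y -> continuous (fun y => k y * rpow (g y) (2 - m)) y.
Proof.
  intros hy. pose proof (hg y hy) as hgy.
  apply (continuous_mult k (fun y => rpow (g y) (2 - m))); [now apply hk|].
  apply (continuous_comp g (fun t => rpow t (2 - m))).
  - apply (antiderivative_continuous I _ g y hdg hy).
  - apply continuous_rpow. powerable.
Qed.

Lemma theta_rate_regular (y : R) :
  I y -> continuous theta_rate y /\ theta_rate y <> 0.
Proof.
  intros hy. pose proof (hg y hy) as hgy. unfold theta_rate. split.
  - apply (continuous_mult (fun _ => rpow P (2 - m))
      (fun y => k y * rpow (g y) (2 - m))); [apply continuous_const|].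
    now apply K_integrand_continuous.
  - repeat (apply Rmult_integral_contrapositive; split); auto;
      apply rpow_neq_0; eapply pow_ok_neq_0; eassumption.
Qed.

Lemma H_denominator_continuous (t : R) :
  pow_ok n m t -> continuous (H_denominator n m S P) t.
Proof.
  intros ht. unfold H_denominator.
  apply (continuous_minus (fun t => rpow P (m - n) * rpow t (3 - n) + rpow t (3 - m))
    (fun t => S * t)).
  - apply (continuous_plus (fun t => rpow P (m - n) * rpow t (3 - n))
      (fun t => rpow t (3 - m))).
    + apply (continuous_mult (fun _ => rpow P (m - n)) (fun t => rpow t (3 - n)));
        [apply continuous_const|].
      apply continuous_rpow. powerable.
    + apply continuous_rpow. powerable.
  - apply (continuous_mult (fun _ => S) (fun t => t));
      [apply continuous_const | apply continuous_id].
Qed.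

Lemma inv_H_denominator_continuous (t : R) :
  pow_ok n m t -> H_denominator n m S P t <> 0 ->
  continuous (fun t => 1 / H_denominator n m S P t) t.
Proof.
  intros ht nz.
  apply (continuous_mult (fun _ => 1) (fun t => / H_denominator n m S P t));
    [apply continuous_const|].
  apply (continuous_comp (H_denominator n m S P) Rinv).
  - now apply H_denominator_continuous.
  - now apply continuous_Rinv.
Qed.

Lemma lienard_solution_of_theta (J : R -> Prop) (y th : R -> R) :
  open J ->
  (forall x, J x ->
     I (y x) /\ pow_ok n m (th x) /\
     is_derive y x (/ (P * g (y x) * th x)) /\
     is_derive th x
       (theta_rate (y x) * H_denominator n m S P (th x) / (P * g (y x) * th x))) ->
  lienard_solution n m f k I J y.
Proof.
  intros hJ h.
  assert (D2 : forall x, J x -> is_derive (Derive y) x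
    (- (f (y x) * rpow (Derive y x) n + k (y x) * rpow (Derive y x) m))).
  { intros x hx. destruct (h x hx) as [hIy [ht [hy hth]]].
    rewrite (is_derive_unique _ _ _ hy).
    rewrite (slope_identity n m S P (f (y x)) (k (y x)) (g (y x)) (th x)) by auto.
    assert (nz : P * g (y x) * th x <> 0).
    { apply (pow_ok_neq_0 n m). repeat apply pow_ok_mult; auto. }
    (* [Derive y] is known to equal this expression only on [J]; openness of [J] makes that enough
       for differentiating. *)
    apply (is_derive_ext_loc (fun x => / (P * g (y x) * th x))).
    { apply (filter_imp J); [|now apply hJ]. intros z hz. symmetry.
      now apply is_derive_unique, (h z hz). }
    fold (theta_rate (y x)).
    pose proof (hdg _ hIy) as hgy.
    auto_derive.
    { repeat split; try easy; eexists; [exact hgy | exact hy | exact hth]. }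
    change (Derive (fun t => y t) x) with (Derive y x).
    change (Derive (fun t => th t) x) with (Derive th x).
    change (Derive (fun t => g t) (y x)) with (Derive g (y x)).
    rewrite (is_derive_unique _ _ _ hth), (is_derive_unique _ _ _ hgy),
      (is_derive_unique _ _ _ hy).
    unfold theta_rate. field.
    repeat split; intros e; apply nz; rewrite e; ring. }
  intros x hx. destruct (h x hx) as [hIy [ht [hy hth]]].
  split; [easy|]. split; [eexists; exact hy|].
  split; [eexists; now apply D2|]. split.
  - rewrite (is_derive_unique _ _ _ hy). apply pow_ok_inv.
    repeat apply pow_ok_mult; auto.
  - rewrite (is_derive_unique _ _ _ (D2 x hx)). ring.
Qed.

(** [theta_along] with the abstract [g]; the two are convertible once [g] is the power of
    [f / k]. *)
Definition slope_theta (y : R -> R) (x : R) : R := 1 / (P * g (y x) * Derive y x).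

Lemma theta_of_lienard_solution (J : R -> Prop) (y : R -> R) (x : R) :
  lienard_solution n m f k I J y -> J x ->
  pow_ok n m (slope_theta y x) /\
  is_derive y x (/ (P * g (y x) * slope_theta y x)) /\
  is_derive (slope_theta y) x
    (theta_rate (y x) * H_denominator n m S P (slope_theta y x) * Derive y x).
Proof.
  intros sol hx. destruct (sol x hx) as [hIy [hy [hy' [hd eqn]]]].
  pose proof (hg _ hIy) as hgy.
  assert (ht : pow_ok n m (slope_theta y x)).
  { unfold slope_theta, Rdiv. rewrite Rmult_1_l.
    apply pow_ok_inv. repeat apply pow_ok_mult; auto. }
  pose proof (pow_ok_neq_0 _ _ _ hP). pose proof (pow_ok_neq_0 _ _ _ hgy).
  pose proof (pow_ok_neq_0 _ _ _ hd). pose proof (pow_ok_neq_0 _ _ _ ht).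
  assert (ed : Derive y x = / (P * g (y x) * slope_theta y x)).
  { unfold slope_theta. field. auto. }
  split; [easy|]. split; [rewrite <- ed; now apply Derive_correct|].
  pose proof (slope_identity n m S P (f (y x)) (k (y x)) (g (y x)) (slope_theta y x)
    hP hgy ht (hfg _ hIy)) as id.
  rewrite <- ed in id.
  set (d := Derive y x) in *.
  fold (theta_rate (y x)) in id.
  set (Q := H_denominator n m S P (slope_theta y x)) in *.
  (* The equation solved for y'' and rewritten by [slope_identity]; [d ^ 3] is the factor
     [1 / w ^ 3] with [w = P g theta]. *)
  assert (e2 : Derive (Derive y) x =
    - ((P * (S * rpow P (2 - m) * k (y x) * rpow (g (y x)) (3 - m)) *
        slope_theta y x + P * g (y x) * (theta_rate (y x) * Q)) * d ^ 3)).
  { rewrite ed. unfold Rdiv in id.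
    replace ((/ (P * g (y x) * slope_theta y x)) ^ 3) with
      (/ (P * g (y x) * slope_theta y x) ^ 3) by (field; auto).
    rewrite <- id. lra. }
  unfold slope_theta at 1.
  auto_derive.
  { repeat split; try easy; [eexists; exact (hdg _ hIy)|].
    repeat (apply Rmult_integral_contrapositive; split); easy. }
  change (Derive (fun t => y t) x) with d.
  change (Derive (fun t => Derive y t) x) with (Derive (Derive y) x).
  change (Derive (fun t => g t) (y x)) with (Derive g (y x)).
  rewrite (is_derive_unique _ _ _ (hdg _ hIy)).
  rewrite e2. unfold slope_theta. fold d. field. auto.
Qed.

(** * The solution family for a fixed interval [T] and fixed antiderivatives *)

Section Family.

Variables (T : R -> Prop) (H Hinv K : R -> R).
Hypotheses (hT : theta_interval n m S P T)
  (hH : antiderivative_on T (fun t => 1 / H_denominator n m S P t) H)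
  (hHinv : forall t, T t -> Hinv (H t) = t)
  (hK : antiderivative_on I (fun y => k y * rpow (g y) (2 - m)) K).

Lemma H_regular : regular T (fun t => 1 / H_denominator n m S P t) H.
Proof.
  destruct hT as [ho h]. split; [now apply open_interval_open_convex|].
  split; [easy|]. intros t ht. destruct (h t ht) as [hp nz].
  split; [now apply inv_H_denominator_continuous|].
  apply Rmult_integral_contrapositive. split; [lra | now apply Rinv_neq_0_compat].
Qed.

Lemma Hinv_argument_regular (c : R) :
  regular I theta_rate (fun y => rpow P (2 - m) * (K y + c)).
Proof.
  split; [now apply open_interval_open_convex|].
  split; [|now apply theta_rate_regular].
  intros y hy. pose proof (hK y hy) as hKy.
  apply is_derive_scal.
  apply (is_derive_ext_loc (fun y => plus (K y) c)); [now apply filter_forall|].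
  rewrite <- (Rplus_0_r (k y * rpow (g y) (2 - m))).
  apply (is_derive_plus K (fun _ => c)); [easy | apply @is_derive_const].
Qed.

Lemma H_range : is_open_interval (fun u => exists t, T t /\ H t = u).
Proof. apply (regular_image T _ H H_regular). apply hT. Qed.

Lemma theta_domain_open_convex (c : R) : open_convex (theta_domain m P I T H K c).
Proof.
  exact (regular_preimage I (fun u => exists t, T t /\ H t = u) _ _
    (Hinv_argument_regular c) (open_interval_open_convex _ H_range)).
Qed.

(** A left inverse of [H] on [T] is also a right inverse on the values of [H], and [theta_domain]
    puts the argument among these. *)
Lemma theta_spec (c y : R) :
  theta_domain m P I T H K c y ->
  T (theta m P Hinv K c y) /\ H (theta m P Hinv K c y) = rpow P (2 - m) * (K y + c).
Proof.
  intros [_ [t [ht e]]]. unfold theta. rewrite <- e, hHinv; auto.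
Qed.

(** Since H' = 1/D, the inverse has derivative D, and the chain rule contributes [theta_rate]. *)
Lemma theta_derive (c y : R) :
  theta_domain m P I T H K c y ->
  is_derive (theta m P Hinv K c) y
    (theta_rate y * H_denominator n m S P (theta m P Hinv K c y)).
Proof.
  intros hy.
  assert (hrange : forall u, (exists t, T t /\ H t = u) -> T (Hinv u) /\ H (Hinv u) = u).
  { intros u [t [ht <-]]. rewrite hHinv; auto. }
  pose proof (regular_inverse_derive T _ _ H Hinv _ H_regular (proj1 H_range)
    hrange (proj2 hy)) as dHinv.
  destruct (Hinv_argument_regular c) as [_ [darg _]].
  pose proof (is_derive_comp Hinv _ y _ _ dHinv (darg y (proj1 hy))) as d.
  replace (theta_rate y * H_denominator n m S P (theta m P Hinv K c y)) with
    (scal (theta_rate y) (/ (1 / H_denominator n m S P (theta m P Hinv K c y)))).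
  - exact d.
  - unfold scal; simpl; unfold mult; simpl. field.
    apply (proj2 hT), (proj1 (theta_spec c y hy)).
Qed.

Lemma theta_pow_ok (c y : R) :
  theta_domain m P I T H K c y -> pow_ok n m (theta m P Hinv K c y).
Proof. intros hy. apply (proj2 hT), (proj1 (theta_spec c y hy)). Qed.

Lemma X_integrand_regular (c y : R) :
  theta_domain m P I T H K c y ->
  continuous (fun y => g y * theta m P Hinv K c y) y /\
  g y * theta m P Hinv K c y <> 0.
Proof.
  intros hy. split.
  - apply (continuous_mult g (theta m P Hinv K c)).
    + apply (antiderivative_continuous I _ g y hdg), hy.
    + apply (ex_derive_continuous (theta m P Hinv K c)).
      eexists. now apply theta_derive.
  - apply (pow_ok_neq_0 n m), pow_ok_mult; [apply hg, hy | now apply theta_pow_ok].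
Qed.

Lemma X_exists :
  exists X : R -> R -> R, forall c, antiderivative_on (theta_domain m P I T H K c)
    (fun y => g y * theta m P Hinv K c y) (X c).
Proof.
  assert (h : forall c, exists U, antiderivative_on (theta_domain m P I T H K c)
    (fun y => g y * theta m P Hinv K c y) U).
  { intros c. apply open_convex_antiderivative; [apply theta_domain_open_convex|].
    intros y hy. now apply X_integrand_regular. }
  exists (fun c => proj1_sig (constructive_indefinite_description _ (h c))).
  intros c. exact (proj2_sig (constructive_indefinite_description _ (h c))).
Qed.

Variable X : R -> R -> R.
Hypothesis hX : forall c, antiderivative_on (theta_domain m P I T H K c)
  (fun y => g y * theta m P Hinv K c y) (X c).

Lemma curve_regular (c x0 : R) :
  regular (theta_domain m P I T H K c)
    (fun y => P * (g y * theta m P Hinv K c y)) (fun y => x0 + P * X c y).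
Proof.
  split; [apply theta_domain_open_convex|]. split.
  - intros y hy. pose proof (hX c y hy) as d.
    rewrite <- (Rplus_0_l (P * (g y * theta m P Hinv K c y))).
    apply (is_derive_plus (fun _ => x0) (fun y => P * X c y));
      [apply @is_derive_const | now apply is_derive_scal].
  - intros y hy. destruct (X_integrand_regular c y hy) as [hc nz]. split.
    + apply (continuous_mult (fun _ => P) (fun y => g y * theta m P Hinv K c y));
        [apply continuous_const | easy].
    + apply Rmult_integral_contrapositive. split; [|easy].
      now apply (pow_ok_neq_0 n m).
Qed.

(** On [J] the family relation says exactly that [y] is a right inverse of the curve [x0 + P * X c],
    so its differentiability is a conclusion. *)
Lemma family_member_derive (c x0 : R) (J : R -> Prop) (y : R -> R) (x : R) :
  open J -> family_member m P I T H K X c x0 J y -> J x ->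
  is_derive y x (/ (P * g (y x) * theta m P Hinv K c (y x))).
Proof.
  intros hJ hy hx. rewrite Rmult_assoc.
  apply (regular_inverse_derive _ J _ _ y x (curve_regular c x0)); auto.
  intros z hz. destruct (hy z hz) as [hd e]. split; [easy | lra].
Qed.

Lemma family_member_solution (c x0 : R) (J : R -> Prop) (y : R -> R) :
  is_open_interval J -> family_member m P I T H K X c x0 J y ->
  lienard_solution n m f k I J y /\
  forall x, J x -> slope_theta y x = theta m P Hinv K c (y x).
Proof.
  intros [hJ _] hy.
  pose proof (fun x => family_member_derive c x0 J y x hJ hy) as dy.
  split.
  - apply lienard_solution_of_theta with (th := fun x => theta m P Hinv K c (y x)); auto.
    intros x hx. destruct (hy x hx) as [hd _].
    split; [apply hd|]. split; [now apply theta_pow_ok|].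
    split; [now apply dy|].
    pose proof (is_derive_comp _ y x _ _ (theta_derive c (y x) hd) (dy x hx)) as d.
    unfold scal in d; simpl in d; unfold mult in d; simpl in d.
    now rewrite Rmult_comm in d.
  - intros x hx. destruct (hy x hx) as [hd _].
    unfold slope_theta. rewrite (is_derive_unique _ _ _ (dy x hx)).
    pose proof (pow_ok_neq_0 _ _ _ hP). pose proof (pow_ok_neq_0 _ _ _ (hg _ (proj1 hd))).
    pose proof (pow_ok_neq_0 _ _ _ (theta_pow_ok c _ hd)). field. auto.
Qed.

Lemma family_member_exists (c x0 y0 : R) :
  theta_domain m P I T H K c y0 ->
  exists (J : R -> Prop) (y : R -> R),
    is_open_interval J /\ J (x0 + P * X c y0) /\
    y (x0 + P * X c y0) = y0 /\ family_member m P I T H K X c x0 J y.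
Proof.
  intros hy0. pose proof (curve_regular c x0) as hr.
  set (A := theta_domain m P I T H K c) in *.
  set (W := fun y => x0 + P * X c y) in *.
  (* A chosen preimage under [W]. [J] is the whole image of [W], so a preimage exists at each of its
     points. *)
  set (V := fun x => epsilon (inhabits 0) (fun v => A v /\ W v = x)).
  assert (hV : forall x, (exists v, A v /\ W v = x) -> A (V x) /\ W (V x) = x) by
    (intros x hx; exact (epsilon_spec _ _ hx)).
  assert (hx0 : exists v, A v /\ W v = x0 + P * X c y0) by now exists y0.
  exists (fun x => exists v, A v /\ W v = x), V.
  split; [apply (regular_image A _ W hr); now exists y0|].
  split; [easy|]. split.
  - destruct (hV _ hx0). now apply (regular_injective A _ W _ _ hr).
  - intros x hx. destruct (hV x hx) as [h e]. split; [easy|].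
    unfold W in e. lra.
Qed.

Lemma solution_family_member (J : R -> Prop) (y : R -> R) :
  is_open_interval J -> lienard_solution n m f k I J y ->
  (forall x, J x -> T (slope_theta y x)) ->
  exists! cx : R * R, family_member m P I T H K X (fst cx) (snd cx) J y.
Proof.
  intros hJ sol hth. pose proof (proj1 (proj2 hJ)) as [x1 hx1].
  assert (hp : rpow P (2 - m) <> 0) by (apply rpow_neq_0, (pow_ok_neq_0 n m), hP).
  (* Solves [H(theta) = P^(2-m) (K(y) + c)] at the base point [x1]. *)
  set (c := H (slope_theta y x1) / rpow P (2 - m) - K (y x1)).
  assert (first : forall x, J x -> H (slope_theta y x) = rpow P (2 - m) * (K (y x) + c)).
  (* Both terms have derivative [theta_rate (y x) * Derive y x]: the denominator in theta' cancels
     against H' = 1/D. *)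
  { assert (d0 : antiderivative_on J (fun _ => 0)
      (fun x => H (slope_theta y x) - rpow P (2 - m) * (K (y x) + c))).
    { intros x hx. destruct (sol x hx) as [hIy [hy _]].
      destruct (theta_of_lienard_solution J y x sol hx) as [_ [_ dth]].
      pose proof (is_derive_comp H _ x _ _ (hH _ (hth x hx)) dth) as d1.
      destruct (Hinv_argument_regular c) as [_ [darg _]].
      pose proof (is_derive_comp _ y x _ _ (darg _ hIy) (Derive_correct _ _ hy)) as d2.
      pose proof (is_derive_minus _ _ _ _ _ d1 d2) as d.
      match type of d with is_derive _ _ ?l => replace l with 0 in d end; [exact d|].
      unfold minus, plus, opp, scal; simpl; unfold mult; simpl. field.
      now apply (proj2 hT), hth. }
    intros x hx.
    pose proof (open_convex_constant J _ x x1 (open_interval_open_convex _ hJ) d0 hx hx1)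
      as e.
    simpl in e. replace (rpow P (2 - m) * (K (y x1) + c)) with
      (H (slope_theta y x1)) in e by (unfold c; field; easy).
    lra. }
  assert (dom : forall x, J x -> theta_domain m P I T H K c (y x)).
  { intros x hx. split; [apply (sol x hx)|]. exists (slope_theta y x); auto. }
  assert (eth : forall x, J x -> theta m P Hinv K c (y x) = slope_theta y x).
  { intros x hx. unfold theta. rewrite <- first, hHinv; auto. }
  exists (c, x1 - P * X c (y x1)). split.
  - simpl. intros x hx. split; [now apply dom|].
    (* The [0] is [curve_regular] taken with zero offset; the constant value of this difference is
       the required [x0]. *)
    assert (d0 : antiderivative_on J (fun _ => 0) (fun x => x - (0 + P * X c (y x)))).
    { intros z hz. destruct (theta_of_lienard_solution J y z sol hz) as [hp' [dy _]].
      destruct (curve_regular c 0) as [_ [dW _]].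
      pose proof (is_derive_comp _ y z _ _ (dW _ (dom z hz)) dy) as d2.
      pose proof (is_derive_minus (fun z => z) _ _ _ _ (is_derive_id z) d2) as d.
      match type of d with is_derive _ _ ?l => replace l with 0 in d end; [exact d|].
      rewrite eth by easy.
      unfold minus, plus, opp, scal, one; simpl; unfold mult; simpl.
      pose proof (pow_ok_neq_0 _ _ _ hP). pose proof (pow_ok_neq_0 _ _ _ hp').
      pose proof (pow_ok_neq_0 _ _ _ (hg _ (proj1 (dom z hz)))). field. auto. }
    pose proof (open_convex_constant J _ x x1 (open_interval_open_convex _ hJ) d0 hx hx1).
    simpl in *. lra.
  - intros [c' x0'] hfam. simpl in hfam.
    (* Theta is fixed by the slope of [y], so applying [H] at [x1] gives the same argument of [Hinv]
       for both constants. *)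
    assert (c = c').
    { destruct (family_member_solution c' x0' J y hJ hfam) as [_ e].
      pose proof (theta_spec c' _ (proj1 (hfam x1 hx1))) as [_ e'].
      rewrite <- e, first in e' by easy.
      apply Rmult_eq_reg_l in e'; [lra | easy]. }
    subst c'. f_equal. destruct (hfam x1 hx1) as [_ e]. lra.
Qed.

End Family.

(* Along a solution theta' = theta_rate(y) D(theta) y' vanishes nowhere, so the
   image of theta is itself an open interval. *)
Lemma solution_theta_interval (J : R -> Prop) (y : R -> R) :
  is_open_interval J -> lienard_solution n m f k I J y ->
  (forall x, J x -> H_denominator n m S P (slope_theta y x) <> 0) ->
  exists T : R -> Prop, theta_interval n m S P T /\
    forall x, J x -> T (slope_theta y x).
Proof.
  intros hJ sol hD.
  assert (hr : regular J (fun x => theta_rate (y x) *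
    H_denominator n m S P (slope_theta y x) * Derive y x) (slope_theta y)).
  { split; [now apply open_interval_open_convex|]. split.
    - intros x hx. now apply (theta_of_lienard_solution J y x sol hx).
    - intros x hx. destruct (sol x hx) as [hIy [hy [hy' [hd _]]]].
      destruct (theta_of_lienard_solution J y x sol hx) as [ht [_ dth]].
      destruct (theta_rate_regular _ hIy) as [hc nz]. split.
      + apply (continuous_mult (fun x => theta_rate (y x) *
          H_denominator n m S P (slope_theta y x)) (Derive y)).
        * apply (continuous_mult (fun x => theta_rate (y x))
            (fun x => H_denominator n m S P (slope_theta y x))).
          -- apply (continuous_comp y theta_rate); [|easy].
             now apply (ex_derive_continuous y).
          -- apply (continuous_comp (slope_theta y) (H_denominator n m S P)).
             ++ apply (ex_derive_continuous (slope_theta y)). eexists. exact dth.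
             ++ now apply H_denominator_continuous.
        * apply (ex_derive_continuous (Derive y)). exact hy'.
      + apply Rmult_integral_contrapositive. split; [|now apply (pow_ok_neq_0 n m)].
        apply Rmult_integral_contrapositive. auto. }
  exists (fun t => exists x, J x /\ slope_theta y x = t). split; [split|].
  - apply (regular_image J _ _ hr), hJ.
  - intros t [x [hx <-]]. split; [|now apply hD].
    apply (theta_of_lienard_solution J y x sol hx).
  - intros x hx. now exists x.
Qed.

End Quadrature.

(** * The theorem, with [g] taken to be the power of [f / k] *)

Theorem theorem4 (n m S P : R) (f k : R -> R) (I : R -> Prop)
  (hn : 0 < n) (hm : 0 < m) (hnm : n <> m)
  (hI : is_open_interval I)
  (hf : smooth_on I f) (hk : smooth_on I k)
  (hf0 : forall y, I y -> f y <> 0) (hk0 : forall y, I y -> k y <> 0)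
  (hP : pow_ok n m P)
  (hfk : (forall y, I y -> 0 < f y / k y) \/
         (is_int n /\ is_int m /\ is_int (1 / (n - m))))
  (hcond :
    (forall y, I y ->
       is_derive (quot_pow f k (1 / (n - m))) y
         (S * rpow P (2 - m) * f y * quot_pow f k ((3 - n) / (n - m)) y)) \/
    (forall y, I y ->
       is_derive (quot_pow f k (1 / (n - m))) y
         (S * rpow P (2 - m) * k y * quot_pow f k ((3 - m) / (n - m)) y))) :
  (forall T : R -> Prop, theta_interval n m S P T ->
     (* the antiderivatives and the local inverse exist *)
     (exists (H Hinv K : R -> R) (X : R -> R -> R),
        quadratures n m S P f k I T H Hinv K X) /\
     forall (H Hinv K : R -> R) (X : R -> R -> R),
       quadratures n m S P f k I T H Hinv K X ->
       (* the formula defines solutions, for all constants c and x0 *)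
       (forall (c x0 : R) (J : R -> Prop) (y : R -> R),
          is_open_interval J ->
          family_member m P I T H K X c x0 J y ->
          lienard_solution n m f k I J y /\
          (forall x, J x ->
             theta_along n m P f k y x = theta m P Hinv K c (y x))) /\
       (* which exist locally through every point of the curve *)
       (forall c x0 y0 : R,
          theta_domain m P I T H K c y0 ->
          exists (J : R -> Prop) (y : R -> R),
            is_open_interval J /\ J (x0 + P * X c y0) /\
            y (x0 + P * X c y0) = y0 /\
            family_member m P I T H K X c x0 J y) /\
       (* every solution with theta in T arises from unique constants *)
       (forall (J : R -> Prop) (y : R -> R),
          is_open_interval J ->
          lienard_solution n m f k I J y ->
          (forall x, J x -> T (theta_along n m P f k y x)) ->
          exists! cx : R * R,
            family_member m P I T H K X (fst cx) (snd cx) J y)) /\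
  (* every solution along which H is defined has theta in some such T *)
  (forall (J : R -> Prop) (y : R -> R),
     is_open_interval J ->
     lienard_solution n m f k I J y ->
     (forall x, J x ->
        H_denominator n m S P (theta_along n m P f k y x) <> 0) ->
     exists T : R -> Prop, theta_interval n m S P T /\
       forall x, J x -> T (theta_along n m P f k y x)).
Proof.
  set (g := quot_pow f k (1 / (n - m))) in *.
  assert (base : forall y, I y -> pow_ok n m (g y) /\
    f y = k y * rpow (g y) (n - m) /\
    forall a, (is_int n -> is_int m -> is_int a) ->
      quot_pow f k (a / (n - m)) y = rpow (g y) a).
  { intros y hy. apply quot_pow_base; auto.
    destruct hfk as [h | h]; [left; now apply h | now right]. }
  assert (hg : forall y, I y -> pow_ok n m (g y)) by (intros; now apply base).
  assert (hfg : forall y, I y -> f y = k y * rpow (g y) (n - m)) by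
    (intros; now apply base).
  assert (hquot : forall y, I y ->
    quot_pow f k ((2 - m) / (n - m)) y = rpow (g y) (2 - m)).
  { intros y hy. apply base; [easy | int_exponent]. }
  (* Since f/k = g^(n-m), both forms of the condition are the same equation. *)
  assert (hdg : forall y, I y ->
    is_derive g y (S * rpow P (2 - m) * k y * rpow (g y) (3 - m))).
  { intros y hy. pose proof (hg y hy) as hgy.
    destruct hcond as [h | h]; specialize (h y hy).
    - rewrite (proj2 (proj2 (base y hy))), (hfg y hy) in h by int_exponent.
      replace (S * rpow P (2 - m) * k y * rpow (g y) (3 - m)) with
        (S * rpow P (2 - m) * (k y * rpow (g y) (n - m)) * rpow (g y) (3 - n));
        [exact h|].
      replace (3 - m) with ((n - m) + (3 - n)) by ring.
      rewrite rpow_plus by powerable. ring.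
    - now rewrite (proj2 (proj2 (base y hy))) in h by int_exponent. }
  assert (hkc : forall y, I y -> continuous k y).
  { intros y hy. apply (ex_derive_continuous k). exact (hk 1%nat y hy). }
  split.
  2: { intros J y hJ sol hD.
       now apply (solution_theta_interval n m S P f k g I hP hkc hk0 hg hfg hdg). }
  intros T hT. split.
  - destruct (open_convex_antiderivative T (fun t => 1 / H_denominator n m S P t))
      as [H hH].
    { now apply open_interval_open_convex, hT. }
    { intros t ht. destruct (proj2 hT t ht) as [hp nz].
      now apply inv_H_denominator_continuous. }
    destruct (open_convex_antiderivative I (fun y => k y * rpow (g y) (2 - m)))
      as [K hK].
    { now apply open_interval_open_convex. }
    { now apply (K_integrand_continuous n m S P k g I). }
    pose proof (H_regular n m S P T H hT hH) as hr.
    (* The inverse picks a preimage in [T]; injectivity of [H] there makes it the original point. *)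
    assert (hHinv : forall t, T t ->
      epsilon (inhabits 0) (fun s => T s /\ H s = H t) = t).
    { intros t ht.
      destruct (epsilon_spec (inhabits 0) (fun s => T s /\ H s = H t)) as [h e].
      { now exists t. }
      exact (regular_injective T _ H _ _ hr h ht e). }
    destruct (X_exists n m S P k g I hP hI hkc hk0 hg hdg T H
      (fun u => epsilon (inhabits 0) (fun s => T s /\ H s = u)) K hT hH hHinv hK)
      as [X hX].
    exists H, (fun u => epsilon (inhabits 0) (fun s => T s /\ H s = u)), K, X.
    split; [easy|]. split; [easy|]. split; [|easy].
    intros y hy. rewrite hquot by easy. now apply hK.
  - intros H Hinv K X [hH [hHinv [hK' hX]]].
    assert (hK : antiderivative_on I (fun y => k y * rpow (g y) (2 - m)) K).
    { intros y hy. rewrite <- hquot by easy. now apply hK'. }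
    split; [|split].
    + intros c x0 J y hJ hy.
      now apply (family_member_solution n m S P f k g I hP hI hkc hk0 hg hfg hdg
        T H Hinv K hT hH hHinv hK X hX c x0).
    + now apply (family_member_exists n m S P k g I hP hI hkc hk0 hg hdg
        T H Hinv K hT hH hHinv hK X hX).
    + now apply (solution_family_member n m S P f k g I hP hI hkc hk0 hg hfg hdg
        T H Hinv K hT hH hHinv hK X hX).
Qed.
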